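(* Let $m,n\in \mathbb{N}$ and $t\in \mathbb{C}$. Then $$\sigma_t(m,n) = \sum_{i\mid m,\ j\mid n} \operatorname{lcm}(i,j)^t\, (\operatorname{id}_t*\varphi)(\gcd(i,j)) = \sum_{d \mid \gcd(m,n)} \varphi(d)\, d^t\, \sigma_t\left(\frac{m}{d} \right)\sigma_t \left(\frac{n}{d} \right).$$
   Context: $\mathbb{N}=\{1,2,\ldots\}$ and $\mathbb{Z}_n$ is the additive group of residue classes modulo $n$. For $t\in\mathbb{C}$ and $m,n\in\mathbb{N}$, the two-variable function is $\sigma_t(m,n)=\sum_{H\le \mathbb{Z}_m\times\mathbb{Z}_n}|H|^t$, the sum being over all subgroups $H$ of $\mathbb{Z}_m\times\mathbb{Z}_n$. The one-variable function is $\sigma_t(n)=\sum_{d\mid n}d^t$. Further, $\operatorname{id}_t(n)=n^t$, $\varphi$ is Euler's totient function, and $(f*g)(n)=\sum_{d\mid n}f(d)g(n/d)$ is Dirichlet convolution. Divisors are positive. *)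

(* Defs.v *)
From mathcomp Require Import reals sequences exp trigo.
From mathcomp Require Import all_boot all_algebra all_fingroup complex.

Set Implicit Arguments.
Unset Strict Implicit.
Unset Printing Implicit Defensive.

Import GRing.Theory Num.Theory.
Local Open Scope ring_scope.
Local Open Scope complex_scope.

(* exp (t ln n) written through the real exponential, cosine and sine, with
   ln n the real logarithm. Only meaningful for n > 0 (ln 0 = 0 in the
   library). *)
Definition cpow (R : realType) (n : nat) (t : R[i]) : R[i] :=
  let l : R := ln n%:R in
  (expR (complex.Re t * l) * cos (complex.Im t * l)) +i*
  (expR (complex.Re t * l) * sin (complex.Im t * l)).

(* 'Z_1 has two elements in the library, so Z_n is taken to be the subgroup
   Zp n of 'Z_n, which has exactly n elements for every n > 0. *)
Definition sigma2 (R : realType) (t : R[i]) (m n : nat) : R[i] :=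
  \sum_(H : {group 'Z_m * 'Z_n} | H \subset setX (Zp m) (Zp n)) cpow #|H| t.

Definition sigma1 (R : realType) (t : R[i]) (n : nat) : R[i] :=
  \sum_(d <- divisors n) cpow d t.

Definition dirichlet (K : pzRingType) (f g : nat -> K) (n : nat) : K :=
  \sum_(d <- divisors n) f d * g (n %/ d)%N.

(* Main.v *)
(* A subgroup H of Z_m x Z_n has |H| = i d, where i is the order of its first
   projection and d that of its fiber {y | (1, y) \in H}. Fix x of order i in
   Z_m. For H of shape (i, d) the y with (x, y) \in H form a coset of the fiber,
   and each y with y^(i d) = 1 comes from exactly one such H; as the cyclic group
   Z_n has gcd(i d, n) such y, there are gcd(i d, n) / d = gcd(i, n / d)
   subgroups of shape (i, d). Expanding this gcd as a sum of totients of its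
   divisors e, and substituting i = e i', n / d = e j', gives the last sum; the
   middle one is brought to it by lcm(i, j) gcd(i, j) / e = i j / e. *)

Require Import Defs.
From mathcomp Require Import reals sequences exp trigo.
From mathcomp Require Import all_boot all_algebra all_fingroup complex.
From mathcomp Require Import cyclic gproduct ring.

Set Implicit Arguments.
Unset Strict Implicit.
Unset Printing Implicit Defensive.

Import GRing.Theory Num.Theory.
Local Open Scope ring_scope.
Local Open Scope complex_scope.

(** * Reindexing of sums over divisors *)

Section DivisorSums.
Local Open Scope ring_scope.
Variable V : nmodType.

Lemma big_uniq_pred1 (I : eqType) (r : seq I) (a : I) (F : I -> V) :
  uniq r -> a \in r -> \sum_(i <- r | a == i) F i = F a.
Proof.
move=> ur ar; rewrite -big_filter (eq_filter (a2 := pred1 a)) => [|i].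
  by rewrite filter_pred1_uniq // big_seq1.
by rewrite /= eq_sym.
Qed.

Lemma big_divisors_mul m e (F : nat -> V) : (0 < m)%N -> (e %| m)%N ->
  \sum_(i <- divisors m | (e %| i)%N) F i =
  \sum_(k <- divisors (m %/ e)) F (e * k)%N.
Proof.
move=> m_gt0 em; have e_gt0 := dvdn_gt0 m_gt0 em.
have me_gt0 : (0 < m %/ e)%N by rewrite divn_gt0 //; apply: dvdn_leq.
rewrite -big_filter -[RHS](big_map (muln e) xpredT F).
apply/perm_big/uniq_perm.
- by rewrite filter_uniq ?divisors_uniq.
- rewrite map_inj_uniq ?divisors_uniq // => a b /eqP.
  by rewrite eqn_pmul2l // => /eqP.
move=> i; rewrite mem_filter -dvdn_divisors //; apply/andP/mapP.
  case=> /dvdnP[k ->] kem; exists k; last exact: mulnC.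
  by rewrite -dvdn_divisors // dvdn_divRL.
case=> k; rewrite -dvdn_divisors // => kme ->.
by rewrite dvdn_mulr // mulnC -dvdn_divRL.
Qed.

Lemma big_divisors_compl n (F : nat -> V) : (0 < n)%N ->
  \sum_(d <- divisors n) F d = \sum_(d <- divisors n) F (n %/ d)%N.
Proof.
move=> n_gt0.
have divK k : (k %| n)%N -> (n %/ (n %/ k))%N = k.
  by move=> kn; rewrite divnA // mulKn.
rewrite -[RHS](big_map (divn n) xpredT F).
apply/perm_big/uniq_perm; first exact: divisors_uniq.
  rewrite map_inj_in_uniq ?divisors_uniq // => a b.
  rewrite -!dvdn_divisors // => an bn eq_ab.
  by rewrite -(divK a) // eq_ab divK.
move=> d; rewrite -dvdn_divisors //; apply/idP/mapP=> [dn|[k]].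
  exists (n %/ d)%N; first by rewrite -dvdn_divisors // dvdn_div.
  by rewrite divK.
by rewrite -dvdn_divisors // => kn ->; rewrite dvdn_div.
Qed.

(** The divisors of gcd(i, j) are the common divisors e of i and j. Once e is summed first, the
    admissible i are the multiples of e among the divisors of m, that is, e times the divisors of m
    / e; likewise for j. Both expressions of the theorem are regrouped by e in this way. *)
Lemma sum_divisors_gcdn m n (F : nat -> nat -> nat -> V) :
    (0 < m)%N -> (0 < n)%N ->
  \sum_(i <- divisors m) \sum_(j <- divisors n)
     \sum_(e <- divisors (gcdn i j)) F e i j =
  \sum_(e <- divisors (gcdn m n)) \sum_(i <- divisors (m %/ e))
     \sum_(j <- divisors (n %/ e)) F e (e * i)%N (e * j)%N.
Proof.
move=> m_gt0 n_gt0; have g_gt0 : (0 < gcdn m n)%N by rewrite gcdn_gt0 m_gt0.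
(* The range of e is made independent of i and j, so that the sums can be exchanged. *)
transitivity (\sum_(i <- divisors m) \sum_(j <- divisors n)
    \sum_(e <- divisors (gcdn m n) | (e %| i)%N && (e %| j)%N) F e i j).
  rewrite !big_seq; apply: eq_bigr => i; rewrite -dvdn_divisors // => im.
  rewrite !big_seq; apply: eq_bigr => j; rewrite -dvdn_divisors // => jn.
  have gij_gt0 : (0 < gcdn i j)%N by rewrite gcdn_gt0 (dvdn_gt0 m_gt0).
  rewrite -[RHS]big_filter; apply/perm_big/uniq_perm; rewrite ?filter_uniq ?divisors_uniq //.
  move=> e; rewrite mem_filter -!dvdn_divisors // !dvdn_gcd.
  case: (boolP (e %| i)%N) => //= ei; case: (boolP (e %| j)%N) => //= ej.
  by rewrite (dvdn_trans ei) ?(dvdn_trans ej).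
under eq_bigr => i _ do
  rewrite (exchange_big_dep (fun e => e %| i)%N) => [|j e _ /andP[]//].
rewrite (exchange_big_dep xpredT) //= big_seq [RHS]big_seq.
apply: eq_bigr => e; rewrite -dvdn_divisors // dvdn_gcd => /andP[em en].
rewrite big_divisors_mul //; apply: eq_bigr => i _.
by rewrite -big_divisors_mul //; apply: eq_bigl => j; rewrite dvdn_mulr.
Qed.

End DivisorSums.

Lemma sum_totient_divisors n :
  (0 < n)%N -> (\sum_(d <- divisors n) totient d)%N = n.
Proof.
move=> n_gt0; rewrite -[RHS]sum_totient_dvd -(big_mkord (dvdn^~ n)).
rewrite -[RHS]big_filter.
apply/perm_big/uniq_perm; rewrite ?filter_uniq ?iota_uniq ?divisors_uniq //.
move=> d; rewrite -dvdn_divisors // mem_filter mem_index_iota ltnS.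
by case: (boolP (d %| n)%N) => //= /dvdn_leq ->.
Qed.

(** * First projection and vertical fiber of a subgroup of a product *)

Section SubgroupsOfProduct.
Variables gT hT : finGroupType.
Local Open Scope nat_scope.
Local Open Scope group_scope.

(** Image and preimage under morphisms, so that both inherit a group structure when [H] is a
    group. *)
Definition first_proj (H : {set gT * hT}) : {set gT} := [morphism of fst] @* H.
Definition vertical_fiber (H : {set gT * hT}) : {set hT} := [morphism of @pair1g gT hT] @*^-1 H.

Canonical first_proj_group (H : {group gT * hT}) := [group of first_proj H].
Canonical vertical_fiber_group (H : {group gT * hT}) :=
  [group of vertical_fiber H].

Lemma in_vertical_fiber (H : {set gT * hT}) y :
  (y \in vertical_fiber H) = ((1, y) \in H).
Proof. by rewrite !inE. Qed.

Lemma mem_first_proj (H : {set gT * hT}) x y :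
  (x, y) \in H -> x \in first_proj H.
Proof.
move=> xyH; rewrite /first_proj.
by have := mem_morphim [morphism of fst] (in_setT (x, y)) xyH.
Qed.

Lemma first_projP (H : {set gT * hT}) x :
  reflect (exists y, (x, y) \in H) (x \in first_proj H).
Proof.
apply: (iffP idP) => [|[y]]; last exact: mem_first_proj.
by case/morphimP=> -[x' y] _ xyH ->; exists y.
Qed.

(** Lagrange for the first projection restricted to [H]: its kernel is the injective image of the
    fiber under y -> (1, y). *)
Lemma card_first_proj_fiber (H : {group gT * hT}) :
  #|H| = (#|first_proj H| * #|vertical_fiber H|)%N.
Proof.
have -> : #|vertical_fiber H| = #|'ker_H [morphism of fst]|.
  rewrite -(card_injm (injm_pair1g gT hT) (subsetT _)).
  congr #|pred_of_set _|; apply/setP=> -[x y].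
  apply/morphimP/idP => [[z _ + [-> ->]]|].
    by rewrite in_vertical_fiber inE => ->; rewrite /= !inE /=.
  rewrite !inE /= => /andP[xyH /eqP x1].
  exists y; [exact: in_setT | by rewrite in_vertical_fiber -x1 | by rewrite x1].
by rewrite /first_proj card_morphim setTI mulnC LagrangeI.
Qed.

Lemma abelian_setX (G : {group gT}) (K : {group hT}) :
  abelian G -> abelian K -> abelian (setX G K).
Proof.
move=> /centsP cG /centsP cK; apply/centsP => -[a b] + [c d].
rewrite !inE /= => /andP[aG bK] /andP[cG' dK].
by congr (_, _); [apply: cG | apply: cK].
Qed.

Lemma expg_pair (x : gT) (y : hT) k : (x, y) ^+ k = (x ^+ k, y ^+ k).
Proof. by elim: k => // k IHk; rewrite !expgS IHk. Qed.

End SubgroupsOfProduct.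

(** * Elements and subgroups of cyclic groups *)

Section Cyclic.
Local Open Scope nat_scope.
Local Open Scope group_scope.

Lemma cyclic_exists_order (gT : finGroupType) (G : {group gT}) d :
  cyclic G -> d %| #|G| -> exists2 x, x \in G & #[x] = d.
Proof.
case/cyclicP=> g defG; rewrite defG => dG; exists (g ^+ (#[g] %/ d)).
  exact: mem_cycle.
by rewrite orderXdiv ?dvdn_div // divnA // mulKn.
Qed.

(** In a cyclic group, inclusion of subgroups amounts to divisibility of their orders; this is
    applied to <[y]> and [D]. *)
Lemma cyclic_mem_order (gT : finGroupType) (G D : {group gT}) y :
  cyclic G -> D \subset G -> y \in G -> (y \in D) = (#[y] %| #|D|).
Proof.
move=> cG sDG yG.
by rewrite (cardSg_cyclic cG) ?cycle_subG.
Qed.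

(** The solutions of y^k = 1 form the subgroup of order gcd(k, #|G|), generated by the [z] of the
    proof. *)
Lemma card_cyclic_Ldiv (gT : finGroupType) (G : {group gT}) k :
  cyclic G -> #|[set y in G | y ^+ k == 1]| = gcdn k #|G|.
Proof.
move=> cG; have [z zG oz] := cyclic_exists_order cG (dvdn_gcdr k #|G|).
rewrite -[RHS]oz; congr #|pred_of_set _|; apply/setP=> y; rewrite !inE.
case: (boolP (y \in G)) => yG /=; last first.
  by apply/esym/negP => /(subsetP (_ : <[z]> \subset G)) yG'; rewrite yG' ?cycle_subG in yG.
by rewrite (cyclic_mem_order cG) ?cycle_subG // -orderE oz dvdn_gcd order_dvdn order_dvdG // andbT.
Qed.
End Cyclic.

(** * Counting subgroups with given orders of projection and fiber *)

Section CountSubgroups.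
Variables (gT hT : finGroupType) (G : {group gT}) (K : {group hT}).
Hypotheses (cycG : cyclic G) (cycK : cyclic K).
Local Open Scope nat_scope.
Local Open Scope group_scope.
Implicit Type H : {group gT * hT}.

Definition shaped_subgroup i d H :=
  [&& H \subset setX G K, #|first_proj H| == i & #|vertical_fiber H| == d].

Lemma first_proj_sub H : H \subset setX G K -> first_proj H \subset G.
Proof.
move=> sH; apply/subsetP=> x /first_projP[y /(subsetP sH)].
by rewrite inE => /andP[].
Qed.

Lemma vertical_fiber_sub H : H \subset setX G K -> vertical_fiber H \subset K.
Proof.
move=> sH; apply/subsetP=> y; rewrite in_vertical_fiber => /(subsetP sH).
by rewrite inE => /andP[].
Qed.

Lemma card_fiber_over H x :
  x \in first_proj H -> #|[set y | (x, y) \in H]| = #|vertical_fiber H|.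
Proof.
case/first_projP=> y0 xy0; rewrite -(card_rcoset (vertical_fiber H) y0).
congr #|pred_of_set _|; apply/setP=> y.
rewrite mem_rcoset in_vertical_fiber inE -(groupMr _ (groupVr xy0)).
by rewrite -[(x, y) * _]/(x * x^-1, y * y0^-1) mulgV.
Qed.

(** The power (x, y)^i = (1, y^i) puts y^i in the fiber, a group of order d. *)
Lemma shaped_subgroup_torsion i d H x y :
  shaped_subgroup i d H -> #[x] = i -> (x, y) \in H -> y ^+ (i * d) = 1.
Proof.
case/and3P=> sH _ /eqP <- ox xyH; rewrite expgM; apply: expg_cardG.
by rewrite in_vertical_fiber -{1}(expg_order x) ox -expg_pair groupX.
Qed.

(** One point above x determines the subgroup: x generates the projection, so every element of [H]
    is a power of (x, y) times a vertical element, and the fibers of [H] and [H'] agree, having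
    equal order in the cyclic group [K]. Used in both directions, this gives uniqueness. *)
Lemma shaped_subgroup_sub i d H H' x y :
    shaped_subgroup i d H -> shaped_subgroup i d H' -> #[x] = i ->
  (x, y) \in H -> (x, y) \in H' -> H \subset H'.
Proof.
case/and3P=> sH /eqP iH /eqP dH /and3P[sH' _ /eqP dH'] ox xyH xyH'.
have xG : x \in G by have /(subsetP sH) := xyH; rewrite inE => /andP[].
apply/subsetP=> -[a b] abH.
have aproj := mem_first_proj abH.
have : a \in <[x]>.
  rewrite (cyclic_mem_order cycG) ?cycle_subG //.
    by rewrite -orderE ox -iH order_dvdG.
  exact: subsetP (first_proj_sub sH) _ aproj.
case/cycleP=> k ak.
have split_ab : (a, b) = (x, y) ^+ k * (1, y ^- k * b).
  by rewrite expg_pair ak; congr (_, _); rewrite /= ?mulg1 ?mulKVg.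
have : y ^- k * b \in vertical_fiber H.
  rewrite in_vertical_fiber -(groupMl _ (groupX k xyH)).
  by rewrite -split_ab.
move=> vb; have vbK := subsetP (vertical_fiber_sub sH) _ vb.
have : y ^- k * b \in vertical_fiber H'.
  rewrite (cyclic_mem_order cycK) ?vertical_fiber_sub // dH' -dH.
  exact: order_dvdG.
by rewrite in_vertical_fiber split_ab => vH; rewrite groupM ?groupX.
Qed.

(** The witness is generated by (x, y) and the vertical copy of <[z]>, with [z] of order d in [K].
    The torsion condition on y keeps the fiber from outgrowing <[z]>. *)
Lemma shaped_subgroup_exists d x y :
    x \in G -> y \in K -> d %| #|K| -> y ^+ (#[x] * d) = 1 ->
  exists2 H, shaped_subgroup #[x] d H & (x, y) \in H.
Proof.
move=> xG yK dK yid; have [z zK oz] := cyclic_exists_order cycK dK.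
have abXY := abelian_setX (cyclic_abelian cycG) (cyclic_abelian cycK).
pose V := [group of setX [1 gT] <[z]>].
have sVX : V \subset setX G K by rewrite setXS ?sub1G ?cycle_subG.
have sxyX : <[(x, y)]> \subset setX G K by rewrite cycle_subG inE /= xG.
(* The ambient group is abelian, so the join is a plain product of sets. *)
have defH : <[(x, y)]> <*> V = <[(x, y)]> * V.
  by apply/comm_joingE/centC/(subset_trans sxyX)/(subset_trans abXY)/centS.
have memH a b : (a, b) \in <[(x, y)]> * V ->
    exists2 k, a = x ^+ k & y ^- k * b \in <[z]>.
  case/mulsgP=> _ [u v] /cycleP[k ->]; rewrite expg_pair.
  rewrite !inE /= => /andP[/eqP-> vz] [-> ->].
  by exists k; rewrite ?mulg1 ?mulKg.
have xyH : (x, y) \in <[(x, y)]> <*> V by rewrite mem_gen // inE cycle_id.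
exists (<[(x, y)]> <*> V)%G => //; apply/and3P; split.
- by rewrite join_subG sxyX.
- apply/eqP; rewrite orderE; congr #|pred_of_set _|; apply/setP=> a.
  apply/first_projP/idP=> [[b]|/cycleP[k ->]].
    by rewrite /= defH => /memH[k -> _]; apply: mem_cycle.
  by exists (y ^+ k); rewrite -expg_pair groupX.
- rewrite -oz orderE; apply/eqP; congr #|pred_of_set _|; apply/setP=> b.
  rewrite in_vertical_fiber; apply/idP/idP => [|bz].
    (* Here x^k = 1, so #[x] divides k and (y^k)^d = 1 by [yid]; hence y^k lies in <[z]>, and b with
       it. *)
    rewrite /= defH => /memH[k xk1]; rewrite groupMl // groupV.
    rewrite (cyclic_mem_order cycK) ?cycle_subG ?groupX // -orderE oz order_dvdn.
    have /dvdnP[q ->] : #[x] %| k by rewrite order_dvdn -xk1.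
    by rewrite -expgM -mulnA mulnC expgM yid expg1n.
  by rewrite /= mem_gen // inE; apply/orP; right; rewrite inE /= set11.
Qed.

Lemma card_shaped_subgroup i d :
    i %| #|G| -> d %| #|K| ->
  #|[pred H | shaped_subgroup i d H]| = gcdn i (#|K| %/ d).
Proof.
move=> iG dK; have [x xG ox] := cyclic_exists_order cycG iG.
have d_gt0 : 0 < d := dvdn_gt0 (cardG_gt0 K) dK.
(* After multiplication by d, the left side counts pairs (H, y) with (x, y) in H, and the right side
   becomes gcd(i d, #|K|), the number of y in [K] with y^(i d) = 1. *)
apply/eqP; rewrite -(eqn_pmul2r d_gt0); apply/eqP.
rewrite muln_gcdl divnK // -card_cyclic_Ldiv // -sum_nat_const -sum1_card.
have fiberE H : shaped_subgroup i d H -> d = \sum_(y | (x, y) \in H) 1.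
  case/and3P=> sH /eqP iH /eqP dH; rewrite -dH -(card_fiber_over (x := x)).
    by rewrite -sum1_card; apply: eq_bigl => y; rewrite inE.
  by rewrite (cyclic_mem_order cycG) ?first_proj_sub ?iH ?ox.
rewrite (eq_bigr _ fiberE).
(* Counting the same pairs by y: each such y lies above x in exactly one H. *)
rewrite (exchange_big_dep (mem [set y in K | y ^+ (i * d) == 1])) /=.
  apply: eq_bigr => y; rewrite inE => /andP[yK /eqP yid].
  rewrite -ox in yid; have [H0 shH0 xyH0] := shaped_subgroup_exists xG yK dK yid.
  rewrite (big_pred1 H0) // => H; rewrite ox in shH0.
  apply/andP/eqP=> [[shH xyH]|->]; last by [].
  apply/val_inj/eqP; rewrite eqEsubset.
  by rewrite (shaped_subgroup_sub shH shH0 ox xyH) ?(shaped_subgroup_sub shH0 shH ox xyH0).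
move=> H y shH xyH; rewrite inE (shaped_subgroup_torsion shH ox xyH) eqxx andbT.
by case/and3P: shH => /subsetP/(_ _ xyH); rewrite inE => /andP[].
Qed.

Lemma sum_subgroups_setX (V : nmodType) (f : nat -> V) :
  (\sum_(H : {group gT * hT} | H \subset setX G K) f #|H| =
   \sum_(i <- divisors #|G|) \sum_(d <- divisors #|K|)
     f (i * d)%N *+ gcdn i (#|K| %/ d))%R.
Proof.
have G_gt0 := cardG_gt0 G; have K_gt0 := cardG_gt0 K.
(* The inner sums have a single term each, at the orders of the projection and the fiber of H;
   exchanging sums then groups the subgroups by shape. *)
transitivity (\sum_(H : {group gT * hT} | H \subset setX G K)
   \sum_(i <- divisors #|G| | #|first_proj H| == i)
     \sum_(d <- divisors #|K| | #|vertical_fiber H| == d) f (i * d)%N)%R.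
  apply: eq_bigr => H sH.
  rewrite big_uniq_pred1 ?divisors_uniq //; last first.
    by rewrite -dvdn_divisors // cardSg ?first_proj_sub.
  rewrite big_uniq_pred1 ?divisors_uniq //; last first.
    by rewrite -dvdn_divisors // cardSg ?vertical_fiber_sub.
  by rewrite -card_first_proj_fiber.
rewrite (exchange_big_dep xpredT) //=.
rewrite !big_seq; apply: eq_bigr => i; rewrite -dvdn_divisors // => iG.
rewrite (exchange_big_dep xpredT) //=.
rewrite !big_seq; apply: eq_bigr => d; rewrite -dvdn_divisors // => dK.
rewrite sumr_const -(card_shaped_subgroup iG dK); congr (_ *+ _)%R.
by apply: eq_card => H; rewrite inE !unfold_in /shaped_subgroup andbA.
Qed.

End CountSubgroups.

(** * Evaluation of the divisor power sums *)

Lemma cyclic_Zp n : (0 < n)%N -> cyclic (Zp n).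
Proof.
(* For n = 1, [Zp n] is the trivial subgroup; beyond that it is all of 'Z_n, generated by 1. *)
case: n => [|[|n]] // _; first exact: cyclic1.
by rewrite /Zp /= Zp_cycle cycle_cyclic.
Qed.

Section Sigma.
Variables (R : realType) (t : R[i]).

(** Logarithms of positive numbers add, so this reduces to the addition formulas for exp, cos and
    sin. *)
Lemma cpowM a b : (0 < a)%N -> (0 < b)%N ->
  cpow (a * b) t = cpow a t * cpow b t.
Proof.
move=> a_gt0 b_gt0; rewrite /cpow natrM lnM ?posrE ?ltr0n //.
rewrite !mulrDr expRD cosD sinD; simpc.
by congr (_ +i* _); ring.
Qed.

Lemma sigma2_gcd m n : (0 < m)%N -> (0 < n)%N ->
  sigma2 t m n = \sum_(i <- divisors m) \sum_(d <- divisors n)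
    cpow (i * d) t *+ gcdn i (n %/ d).
Proof.
move=> m_gt0 n_gt0.
have := sum_subgroups_setX (G := Zp_group m) (K := Zp_group n)
  (cyclic_Zp m_gt0) (cyclic_Zp n_gt0) (fun k => cpow k t).
by rewrite /= !card_Zp.
Qed.

Lemma sigma2_totient m n : (0 < m)%N -> (0 < n)%N ->
  sigma2 t m n = \sum_(d <- divisors (gcdn m n))
    (totient d)%:R * cpow d t * sigma1 t (m %/ d) * sigma1 t (n %/ d).
Proof.
move=> m_gt0 n_gt0; rewrite sigma2_gcd //.
(* With j = n / d, the multiplicity gcd(i, j) is expanded into totients. *)
transitivity (\sum_(i <- divisors m) \sum_(j <- divisors n)
    \sum_(e <- divisors (gcdn i j))
      (totient e)%:R * cpow (i * (n %/ j)) t).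
  rewrite !big_seq; apply: eq_bigr => i; rewrite -dvdn_divisors // => im.
  rewrite big_divisors_compl // !big_seq; apply: eq_bigr => j.
  rewrite -dvdn_divisors // => jn; rewrite divnA // mulKn //.
  rewrite -mulr_suml -natr_sum sum_totient_divisors ?mulr_natl //.
  by rewrite gcdn_gt0 (dvdn_gt0 m_gt0).
rewrite sum_divisors_gcdn // !big_seq; apply: eq_bigr => e.
rewrite -dvdn_divisors ?gcdn_gt0 ?m_gt0 // dvdn_gcd => /andP[em en].
have e_gt0 := dvdn_gt0 m_gt0 em.
have me_gt0 : (0 < m %/ e)%N by rewrite divn_gt0 //; apply: dvdn_leq.
have ne_gt0 : (0 < n %/ e)%N by rewrite divn_gt0 //; apply: dvdn_leq.
rewrite -mulrA /sigma1 big_distrlr /= mulr_sumr !big_seq; apply: eq_bigr => i.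
rewrite -dvdn_divisors // => ime; have i_gt0 := dvdn_gt0 me_gt0 ime.
(* The left side carries the codivisor (n / e) / j, so the second divisor sum is reversed to
   match. *)
rewrite [in RHS]big_divisors_compl // mulr_sumr !big_seq; apply: eq_bigr => j.
rewrite -dvdn_divisors // => jne; have j_gt0 := dvdn_gt0 ne_gt0 jne.
rewrite divnMA !cpowM ?muln_gt0 ?e_gt0 //; first by rewrite !mulrA.
by rewrite divn_gt0 //; apply: dvdn_leq.
Qed.

Lemma lcm_gcd_totient m n : (0 < m)%N -> (0 < n)%N ->
  \sum_(i <- divisors m) \sum_(j <- divisors n)
    cpow (lcmn i j) t *
    dirichlet (fun k => cpow k t) (fun k => (totient k)%:R : R[i]) (gcdn i j)
  = \sum_(d <- divisors (gcdn m n))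
      (totient d)%:R * cpow d t * sigma1 t (m %/ d) * sigma1 t (n %/ d).
Proof.
move=> m_gt0 n_gt0.
transitivity (\sum_(i <- divisors m) \sum_(j <- divisors n)
    \sum_(e <- divisors (gcdn i j)) (totient e)%:R * cpow (i * j %/ e) t).
  rewrite !big_seq; apply: eq_bigr => i; rewrite -dvdn_divisors // => im.
  rewrite !big_seq; apply: eq_bigr => j; rewrite -dvdn_divisors // => jn.
  have i_gt0 := dvdn_gt0 m_gt0 im; have j_gt0 := dvdn_gt0 n_gt0 jn.
  have g_gt0 : (0 < gcdn i j)%N by rewrite gcdn_gt0 i_gt0.
  (* Reversing the convolution puts the totient at e and the power at gcd(i, j) / e, which merges
     with the lcm. *)
  rewrite /dirichlet big_divisors_compl // mulr_sumr !big_seq.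
  apply: eq_bigr => e; rewrite -dvdn_divisors // => eg.
  have e_gt0 := dvdn_gt0 g_gt0 eg.
  have ge_gt0 : (0 < gcdn i j %/ e)%N by rewrite divn_gt0 //; apply: dvdn_leq.
  rewrite divnA // mulKn // mulrA -cpowM ?lcmn_gt0 ?i_gt0 //.
  by rewrite muln_divA // muln_lcm_gcd mulrC.
rewrite sum_divisors_gcdn // !big_seq; apply: eq_bigr => e.
rewrite -dvdn_divisors ?gcdn_gt0 ?m_gt0 // dvdn_gcd => /andP[em en].
have e_gt0 := dvdn_gt0 m_gt0 em.
have me_gt0 : (0 < m %/ e)%N by rewrite divn_gt0 //; apply: dvdn_leq.
have ne_gt0 : (0 < n %/ e)%N by rewrite divn_gt0 //; apply: dvdn_leq.
rewrite -mulrA /sigma1 big_distrlr /= mulr_sumr !big_seq; apply: eq_bigr => i.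
rewrite -dvdn_divisors // => ime; have i_gt0 := dvdn_gt0 me_gt0 ime.
rewrite mulr_sumr !big_seq; apply: eq_bigr => j.
rewrite -dvdn_divisors // => jne; have j_gt0 := dvdn_gt0 ne_gt0 jne.
(* After the substitution, (e i)(e j) / e = e i j splits into three powers. *)
rewrite mulnCA mulKn // !cpowM ?muln_gt0 ?e_gt0 //.
by rewrite !mulrA.
Qed.

End Sigma.

Theorem theorem1 (R : realType) (m n : nat) (t : R[i])
    (hm : (0 < m)%N) (hn : (0 < n)%N) :
  sigma2 t m n =
    \sum_(i <- divisors m) \sum_(j <- divisors n)
      cpow (lcmn i j) t *
      dirichlet (fun k => cpow k t) (fun k => (totient k)%:R : R[i]) (gcdn i j)
  /\
  \sum_(i <- divisors m) \sum_(j <- divisors n)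
      cpow (lcmn i j) t *
      dirichlet (fun k => cpow k t) (fun k => (totient k)%:R : R[i]) (gcdn i j)
  = \sum_(d <- divisors (gcdn m n))
      (totient d)%:R * cpow d t * sigma1 t (m %/ d)%N * sigma1 t (n %/ d)%N.
Proof. by rewrite sigma2_totient // lcm_gcd_totient. Qed.
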